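(* Let $(\mathfrak{g},\bullet,\langle\;,\;\rangle)$ be a left Leibniz algebra endowed with a positive definite symmetric bilinear form for which every right multiplication $\mathrm{R}_u:v\mapsto v\bullet u$ is skew-symmetric (that is, an $\mathrm{R}$-quadratic Euclidean left Leibniz algebra). Then $(\mathfrak{g},\bullet)$ is a Lie algebra.
   Context: Algebras are real and finite dimensional. $(\mathfrak{g},\bullet)$ is left Leibniz if $u\bullet(v\bullet w)=(u\bullet v)\bullet w+v\bullet(u\bullet w)$ for all $u,v,w\in\mathfrak{g}$. *)

(* Defs.v *)
From mathcomp Require Import all_boot all_order all_algebra.
From mathcomp Require Import sesquilinear.
From mathcomp Require Import reals.

Set Implicit Arguments.
Unset Strict Implicit.
Unset Printing Implicit Defensive.

Import Order.TTheory GRing.Theory Num.Theory.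
Local Open Scope ring_scope.

Section Algebras.
Variables (R : realType) (g : vectType R).
Implicit Type mul : {bilinear g -> g -> g}.

Definition left_leibniz mul : Prop :=
  forall u v w : g, mul u (mul v w) = mul (mul u v) w + mul v (mul u w).

Definition lie mul : Prop :=
  (forall u : g, mul u u = 0) /\
  (forall u v w : g, mul u (mul v w) + mul v (mul w u) + mul w (mul u v) = 0).

Definition right_mul mul (u : g) : g -> g := fun v => mul v u.

(* For a real space, {dot g for idfun} is the type of positive definite
   symmetric bilinear forms: Hermitian symmetry with trivial conjugation. *)
Definition skew_endo (ip : {dot g for (@idfun R)}) (f : g -> g) : Prop :=
  forall v w : g, ip (f v) w = - ip v (f w).

Definition R_quadratic mul (ip : {dot g for (@idfun R)}) : Prop :=
  forall u : g, skew_endo ip (right_mul mul u).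

End Algebras.

(* Main.v *)
Require Import Defs.
From mathcomp Require Import all_boot all_order all_algebra.
From mathcomp Require Import sesquilinear.
From mathcomp Require Import reals.
Import Order.TTheory GRing.Theory Num.Theory.
Local Open Scope ring_scope.

(** In a left Leibniz algebra every square acts trivially on the left: the
    identity at (u, u, w) reads u(uw) = (uu)w + u(uw). Skew-symmetry of the
    right multiplication by u moves one factor of the square across the inner
    product, <uu, uu> = - <u, (uu)u> = 0, so definiteness gives uu = 0. The
    product is therefore alternating, and for an alternating product the left
    Leibniz identity is the Jacobi identity. *)

Lemma left_leibniz_mul_square (R : realType) (g : vectType R)
    (mul : {bilinear g -> g -> g}) (leibniz_mul : left_leibniz mul) (u w : g) :
  mul (mul u u) w = 0.
Proof. by apply: (addIr (mul u (mul u w))); rewrite -leibniz_mul add0r. Qed.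

Lemma alternating_anticomm (R : realType) (g : vectType R)
    (mul : {bilinear g -> g -> g}) (mulxx : forall u : g, mul u u = 0)
    (u v : g) :
  mul u v = - mul v u.
Proof.
apply/eqP; rewrite -addr_eq0; apply/eqP.
by have := mulxx (u + v); rewrite linearDl !linearDr /= !mulxx add0r addr0.
Qed.

Lemma left_leibniz_alternating_lie (R : realType) (g : vectType R)
    (mul : {bilinear g -> g -> g}) (leibniz_mul : left_leibniz mul)
    (mulxx : forall u : g, mul u u = 0) :
  lie mul.
Proof.
split=> // u v w.
rewrite leibniz_mul (alternating_anticomm _ _ mul mulxx w (mul u v)).
rewrite (alternating_anticomm _ _ mul mulxx w u) linearNr /=.
by rewrite addrK subrr.
Qed.

Theorem proposition4p3 (R : realType) (g : vectType R)
    (mul : {bilinear g -> g -> g}) (ip : {dot g for (@idfun R)})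
    (leibniz_mul : left_leibniz mul) (quadratic_ip : R_quadratic mul ip) :
  lie mul.
Proof.
apply: left_leibniz_alternating_lie => // u.
have norm0 : ip (mul u u) (mul u u) = 0.
  rewrite [LHS](quadratic_ip u u (mul u u)).
  by rewrite /right_mul left_leibniz_mul_square // linear0r oppr0.
apply/eqP/contraT => /(neq0_dnorm_gt0 (s := ip)).
by rewrite norm0 ltxx.
Qed.
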